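(* Let $P$ be any finite ranked poset and let $p\in P$. Then the toggleability statistic $\mathfrak{T}_p$ is homomesic with average value $0$ (that is, $0$-mesic) with respect to the toggle group action $\mathrm{Gyr}$: for every orbit $\mathcal{O}\subseteq J(P)$ of the bijection $\mathrm{Gyr}:J(P)\to J(P)$, $$\frac{1}{|\mathcal{O}|}\sum_{I\in\mathcal{O}}\mathfrak{T}_p(I)=0.$$
   Context: For a finite poset $P$, an order ideal is a subset $I\subseteq P$ such that $p\in I$ and $q\le p$ imply $q\in I$; $J(P)$ denotes the set of all order ideals of $P$. For $X\subseteq P$, $X_{\max}$ and $X_{\min}$ denote the sets of maximal and minimal elements of $X$, respectively. A poset $P$ is ranked if it is equipped with a rank function $\mathrm{rk}:P\to\mathbb{Z}_{\ge 0}$ such that $\mathrm{rk}(p)=\mathrm{rk}(q)+1$ whenever $p$ covers $q$. For $p\in P$, the toggle $t_p:J(P)\to J(P)$ is the involution given by $t_p(I)=I\cup\{p\}$ if $p\in(P\setminus I)_{\min}$, $t_p(I)=I\setminus\{p\}$ if $p\in I_{\max}$, and $t_p(I)=I$ otherwise. Toggles $t_p$ and $t_q$ commute whenever neither of $p,q$ covers the other; in particular, toggles at elements whose ranks have the same parity commute. For a finite ranked poset $P$, gyration $\mathrm{Gyr}:J(P)\to J(P)$ is the bijection which first applies the toggles $t_p$ for all $p$ of even rank (in any order) and then applies the toggles $t_p$ for all $p$ of odd rank (in any order). For $p\in P$, the toggleability statistic $\mathfrak{T}_p:J(P)\to\{-1,0,1\}$ is defined by $\mathfrak{T}_p(I)=1$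 if $p\in(P\setminus I)_{\min}$, $\mathfrak{T}_p(I)=-1$ if $p\in I_{\max}$, and $\mathfrak{T}_p(I)=0$ otherwise. Given a finite set $X$, an invertible map $\tau:X\to X$ and a statistic $f:X\to\mathbb{Z}$, $f$ is called homomesic with average value $c$ (or $c$-mesic) with respect to $\tau$ if $\frac{1}{|\mathcal{O}|}\sum_{x\in\mathcal{O}}f(x)=c$ for every $\tau$-orbit $\mathcal{O}\subseteq X$. *)

(* Defs.v *)
From HB Require Import structures.
From mathcomp Require Import all_boot all_order all_algebra all_fingroup.

Set Implicit Arguments.
Unset Strict Implicit.
Unset Printing Implicit Defensive.

Import Order.TTheory GRing.Theory.

Definition is_ideal {d} {P : finPOrderType d} (I : {set P}) : bool :=
  [forall p in I, forall q, (q <= p)%O ==> (q \in I)].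

Notation ideals P := {I : {set P} | is_ideal I}.

Definition max_elts {d} {P : finPOrderType d} (X : {set P}) : {set P} :=
  [set x in X | [forall y in X, ~~ (x < y)%O]].

Definition min_elts {d} {P : finPOrderType d} (X : {set P}) : {set P} :=
  [set x in X | [forall y in X, ~~ (y < x)%O]].

Definition covers {d} {P : finPOrderType d} (p q : P) : bool :=
  (q < p)%O && [forall r : P, ~~ (q < r < p)%O].

Definition is_rank {d} {P : finPOrderType d} (rk : P -> nat) : Prop :=
  forall p q : P, covers p q -> rk p = (rk q).+1.

Definition toggle_set {d} {P : finPOrderType d} (p : P) (I : {set P}) : {set P} :=
  if p \in min_elts (~: I) then p |: I
  else if p \in max_elts I then I :\ p
  else I.

Lemma is_idealP {d} {P : finPOrderType d} (I : {set P}) :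
  reflect (forall p q, p \in I -> (q <= p)%O -> q \in I) (is_ideal I).
Proof.
apply: (iffP forall_inP) => [H p q pI qp | H p pI].
  by have /forallP/(_ q)/implyP := H p pI; apply.
by apply/forallP => q; apply/implyP; apply: H.
Qed.

Lemma max_eltsP {d} {P : finPOrderType d} (X : {set P}) x :
  reflect (x \in X /\ forall y, y \in X -> ~~ (x < y)%O) (x \in max_elts X).
Proof. by rewrite inE; apply: (iffP andP) => -[xX /forall_inP]. Qed.

Lemma min_eltsP {d} {P : finPOrderType d} (X : {set P}) x :
  reflect (x \in X /\ forall y, y \in X -> ~~ (y < x)%O) (x \in min_elts X).
Proof. by rewrite inE; apply: (iffP andP) => -[xX /forall_inP]. Qed.

Lemma toggle_set_ideal {d} {P : finPOrderType d} (p : P) (I : {set P}) :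
  is_ideal I -> is_ideal (toggle_set p I).
Proof.
move=> idI; have /is_idealP clI := idI; rewrite /toggle_set.
case: min_eltsP => [[_ minp]|_].
  apply/is_idealP => x y; rewrite !inE => /predU1P[-> | xI] le_yx.
    have [//|neq_yp] := eqVneq y p; apply: contraT => /= yI.
    by have := minp y; rewrite inE lt_neqAle neq_yp le_yx /= => /(_ yI).
  by rewrite (clI x) ?orbT.
case: max_eltsP => // -[_ maxp]; apply/is_idealP => x y.
rewrite !inE => /andP[neq_xp xI] le_yx; rewrite (clI x) // andbT.
apply: contra (maxp x xI) => /eqP def_y.
by rewrite lt_neqAle -def_y le_yx andbT eq_sym def_y.
Qed.

Lemma toggle_setK {d} {P : finPOrderType d} (p : P) (I : {set P}) :
  is_ideal I -> toggle_set p (toggle_set p I) = I.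
Proof.
move=> idI; have /is_idealP clI := idI; rewrite {2}/toggle_set.
case: (min_eltsP _ p) => [[pI minp]|minp].
  rewrite inE in pI; rewrite /toggle_set !inE eqxx /= ifT ?setU1K //.
  apply/forall_inP => y; rewrite !inE => /predU1P[->|yI]; first by rewrite ltxx.
  by apply: contra pI => /ltW; apply: clI.
case: (max_eltsP _ p) => [[pI maxp]|maxp]; last first.
  rewrite /toggle_set; case: (min_eltsP _ p) => // _.
  by case: (max_eltsP _ p).
rewrite /toggle_set !inE eqxx /= ifT ?setD1K //.
apply/forall_inP => y; rewrite !inE negb_and negbK => /predU1P[->|yI].
  by rewrite ltxx.
by apply: contra yI => /ltW; apply: clI.
Qed.

Definition toggle_fun {d} {P : finPOrderType d} (p : P) (I : ideals P) :
    ideals P :=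
  exist _ (toggle_set p (val I)) (toggle_set_ideal p (valP I)).

Lemma toggle_funK {d} {P : finPOrderType d} (p : P) :
  involutive (@toggle_fun d P p).
Proof. by move=> I; apply/val_inj; exact: toggle_setK (valP I). Qed.

Definition toggle {d} {P : finPOrderType d} (p : P) : {perm ideals P} :=
  perm (inv_inj (toggle_funK p)).

(* The product of permutations applies its left factor first, so the elements
   of even rank are toggled before those of odd rank.  The order within each of
   the two products is that of the enumeration of P; by gyrE below it is
   irrelevant when rk is a rank function. *)
Definition gyr {d} {P : finPOrderType d} (rk : P -> nat) : {perm ideals P} :=
  ((\prod_(p : P | ~~ odd (rk p)) toggle p) *
   (\prod_(p : P | odd (rk p)) toggle p))%g.

Definition toggleability {d} {P : finPOrderType d} (p : P) (I : ideals P) : int :=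
  if p \in min_elts (~: val I) then 1%R
  else if p \in max_elts (val I) then (-1)%R
  else 0%R.

Definition homomesic {X : finType} (tau : {perm X}) (f : X -> int) (c : rat) :
    Prop :=
  forall O : {set X}, O \in porbits tau ->
    (#|O|%:R^-1 * (\sum_(x in O) f x)%:~R = c)%R.

Lemma toggleE {d} {P : finPOrderType d} (p : P) (I : ideals P) :
  val (toggle p I) = toggle_set p (val I).
Proof. by rewrite permE. Qed.

Lemma toggleK {d} {P : finPOrderType d} (p : P) :
  involutive (@toggle d P p).
Proof. by move=> I; rewrite !permE toggle_funK. Qed.

Lemma toggle_mem {d} {P : finPOrderType d} (p q : P) (I : ideals P) :
  q != p -> (q \in val (toggle p I)) = (q \in val I).
Proof.
move=> neq_qp; rewrite toggleE /toggle_set.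
by case: ifP => _; last case: ifP => _; rewrite // !inE ?(negPf neq_qp).
Qed.

Lemma coversPn {d} {P : finPOrderType d} (p q : P) :
  ~~ covers p q -> (q < p)%O -> exists r : P, (q < r < p)%O.
Proof.
rewrite /covers => + lt_qp; rewrite lt_qp => /forallPn[r].
by rewrite negbK; exists r.
Qed.

Lemma toggle_set_indep {d} {P : finPOrderType d} (p q : P) (I : {set P}) :
    is_ideal I -> q \in min_elts (~: I) ->
    p != q -> ~~ covers p q -> ~~ covers q p ->
  (p \in min_elts (~: (q |: I))) = (p \in min_elts (~: I)) /\
  (p \in max_elts (q |: I)) = (p \in max_elts I).
Proof.
move=> /is_idealP clI /min_eltsP[qI minq] neq_pq ncov_pq ncov_qp.
rewrite inE in qI; split; rewrite !inE (negPf neq_pq) /=.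
  have [//|pI] := boolP (p \in I).
  apply/forall_inP/forall_inP => H y; last first.
    by rewrite !inE negb_or => /andP[_ yI]; apply: H; rewrite inE.
  rewrite inE => yI; have [->|neq_yq] := eqVneq y q; last first.
    by apply: H; rewrite !inE negb_or neq_yq.
  apply/negP => /(coversPn ncov_pq)[r /andP[lt_qr lt_rp]].
  have Hr := H r; rewrite !inE lt_rp in Hr.
  suff rI : r \in I by rewrite (clI r q rI (ltW lt_qr)) in qI.
  apply: contraT => rI; have [def_r|neq_rq] := eqVneq r q.
    by rewrite def_r ltxx in lt_qr.
  by have := Hr; rewrite (negPf neq_rq) rI => /(_ isT).
have [pI|//] := boolP (p \in I).
apply/forall_inP/forall_inP => H y; first by move=> yI; apply: H; rewrite !inE yI orbT.
rewrite !inE => /predU1P[->|]; last exact: H.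
apply/negP => /(coversPn ncov_qp)[r /andP[lt_pr lt_rq]].
have rI : r \in I by apply: contraT => rI; have := minq r; rewrite inE lt_rq => /(_ rI).
by have := H r rI; rewrite lt_pr.
Qed.

Lemma toggle_indep {d} {P : finPOrderType d} (p q : P) (I : ideals P) :
    p != q -> ~~ covers p q -> ~~ covers q p ->
  (p \in min_elts (~: val (toggle q I))) = (p \in min_elts (~: val I)) /\
  (p \in max_elts (val (toggle q I))) = (p \in max_elts (val I)).
Proof.
move=> neq_pq ncov_pq ncov_qp.
have addP (K : ideals P) : q \in min_elts (~: val K) ->
    val (toggle q K) = q |: val K by rewrite toggleE /toggle_set => ->.
have [qI|qI] := boolP (q \in min_elts (~: val I)).
  by rewrite addP //; apply: toggle_set_indep; rewrite ?(valP I).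
have [qI'|qI'] := boolP (q \in min_elts (~: val (toggle q I))).
  have := toggle_set_indep (valP (toggle q I)) qI' neq_pq ncov_pq ncov_qp.
  by rewrite -addP // toggleK => -[-> ->].
suff -> : val (toggle q I) = val I by [].
move: qI qI'; rewrite toggleE /toggle_set => /negPf-> .
have [qI|//] := boolP (q \in max_elts (val I)).
move: qI => /max_eltsP[qI _] /negP[]; apply/min_eltsP.
split=> [|y]; first by rewrite !inE eqxx.
rewrite !inE negb_and negbK => /predU1P[->|yI]; first by rewrite ltxx.
have /is_idealP clI := valP I.
by apply: contra yI => /ltW; apply: clI.
Qed.

Lemma toggle_commute {d} {P : finPOrderType d} (p q : P) :
  ~~ covers p q -> ~~ covers q p -> commute (toggle p) (toggle q).
Proof.
have [->//|neq_pq] := eqVneq p q => ncov_pq ncov_qp.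
have key (a b : P) (I : ideals P) : a != b -> ~~ covers a b -> ~~ covers b a ->
    (a \in val (toggle a (toggle b I))) = (a \in val (toggle a I)).
  move=> neq_ab ncov_ab ncov_ba.
  have [Emin Emax] := toggle_indep I neq_ab ncov_ab ncov_ba.
  rewrite !(toggleE a) /toggle_set Emin Emax.
  by case: ifP => _; last case: ifP => _; rewrite ?inE ?eqxx // toggle_mem.
apply/permP => I; rewrite !permM; apply/val_inj/setP => x.
have [->|neq_xp] := eqVneq x p.
  by rewrite toggle_mem // key.
have [->|neq_xq] := eqVneq x q.
  have neq_qp : q != p by rewrite eq_sym.
  by rewrite key // [RHS]toggle_mem.
by rewrite !toggle_mem.
Qed.

Lemma perm_prod_commute {T : eqType} {gT : groupType} (F : T -> gT)
    (s t : seq T) :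
    perm_eq s t -> {in s &, forall x y, commute (F x) (F y)} ->
  (\prod_(x <- s) F x = \prod_(x <- t) F x)%g.
Proof.
elim: s t => [|x s IHs] t eq_st com.
  by move: eq_st; rewrite perm_sym => /perm_nilP->.
have xt : x \in t by rewrite -(perm_mem eq_st) mem_head.
case/splitPr: xt eq_st => t1 t2.
rewrite perm_sym perm_catC /= perm_cons perm_catC perm_sym => eq_st.
rewrite big_cons (IHs _ eq_st); last first.
  by move=> y z ys zs; apply: com; rewrite inE ?ys ?zs orbT.
rewrite !big_cat big_cons /= !mulgA; congr (_ * _)%g.
have: {subset t1 <= s} by move=> y yt; rewrite (perm_mem eq_st) mem_cat yt.
elim: (t1) => [|y u IHu] sub_us; first by rewrite big_nil mulg1 mul1g.
rewrite big_cons -mulgA -IHu; last by move=> z zu; rewrite sub_us // inE zu orbT.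
rewrite !mulgA; congr (_ * _)%g.
by apply: com; rewrite inE ?eqxx // sub_us ?orbT // mem_head.
Qed.

Lemma gyrE {d} {P : finPOrderType d} (rk : P -> nat) (s t : seq P) :
    is_rank rk ->
    uniq s -> (forall p, (p \in s) = ~~ odd (rk p)) ->
    uniq t -> (forall p, (p \in t) = odd (rk p)) ->
  gyr rk = ((\prod_(p <- s) toggle p) * (\prod_(p <- t) toggle p))%g.
Proof.
move=> rkP Us mem_s Ut mem_t.
have ncov (p q : P) : odd (rk p) = odd (rk q) -> ~~ covers p q.
  by move=> eq_pq; apply/negP => /rkP rkE; move: eq_pq; rewrite rkE /=; case: odd.
have com (p q : P) : odd (rk p) = odd (rk q) -> commute (toggle p) (toggle q).
  by move=> eq_pq; apply: toggle_commute; apply: ncov.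
have prodE (Q : pred P) (u : seq P) : uniq u -> u =i Q ->
    {in u &, forall p q, odd (rk p) = odd (rk q)} ->
    (\prod_(p | Q p) toggle p = \prod_(p <- u) toggle p)%g.
  move=> Uu mem_u par; have [e big_e [Ue mem_e] _] := big_enumP Q.
  rewrite -big_e; symmetry; apply: perm_prod_commute.
    by apply: uniq_perm => // p; rewrite mem_u mem_e.
  by move=> p q pu qu; apply/com/par.
rewrite /gyr (prodE _ s) ?(prodE _ t) // => p q.
  by rewrite !mem_t => -> ->.
by rewrite !mem_s => /negPf-> /negPf->.
Qed.

(* Main.v *)
(* Let chi be the indicator of p \in I: toggling p changes chi by T_p(I), and
   toggling any other element leaves chi alone.  If p has even rank it may be
   toggled first, so T_p(I) = chi(Gyr I) - chi(I).  If p has odd rank it may be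
   toggled last, and since T_p changes sign under t_p,
   T_p(Gyr I) = chi(I) - chi(Gyr I).  Both differences cancel over an orbit. *)
Require Import Defs.
From mathcomp Require Import all_boot all_order all_algebra all_fingroup.

Set Implicit Arguments.
Unset Strict Implicit.
Unset Printing Implicit Defensive.

Import GRing.Theory.

Local Open Scope ring_scope.

(** Since [g] maps each of its orbits bijectively onto itself, the sum can be reindexed along [g].
    This is what makes differences of the form [f (g x) - f x] cancel over an orbit. *)
Lemma sum_porbit_shift (X : finType) (V : nmodType) (g : {perm X}) (f : X -> V)
    (O : {set X}) :
  O \in porbits g -> \sum_(x in O) f (g x) = \sum_(x in O) f x.
Proof.
case/imsetP=> x _ ->; rewrite [RHS](reindex_inj (@perm_inj _ g)).
apply: eq_bigl => y; rewrite -!eq_porbit_mem.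
by have := porbit_perm g 1 y; rewrite expg1 => ->.
Qed.

Section Toggleability.
Context {d : Order.disp_t} {P : finPOrderType d}.
Implicit Types (p : P) (I : ideals P).

Definition mem_stat p I : int := (p \in val I)%:R.

Lemma mem_stat_toggle p I :
  mem_stat p (toggle p I) = mem_stat p I + toggleability p I.
Proof.
rewrite /mem_stat toggleE /toggle_set /toggleability.
case: min_eltsP => [[pI _]|_].
  by move: pI; rewrite !inE eqxx => /negPf->.
by case: max_eltsP => [[pI _]|_]; rewrite ?addr0 // !inE eqxx pI.
Qed.

(** Toggling twice at [p] restores [I], so the two successive increments of [mem_stat p] add up to
    zero. *)
Lemma toggleability_toggle p I :
  toggleability p (toggle p I) = - toggleability p I.
Proof.
have := mem_stat_toggle p (toggle p I).
rewrite toggleK mem_stat_toggle -addrA -{1}[mem_stat p I]addr0.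
by move/addrI/esym/eqP; rewrite addrC addr_eq0 => /eqP.
Qed.

Lemma mem_stat_toggle_prod p (s : seq P) I :
  p \notin s -> mem_stat p ((\prod_(q <- s) toggle q)%g I) = mem_stat p I.
Proof.
elim: s I => [|q s IHs] I; first by rewrite big_nil perm1.
rewrite inE negb_or big_cons permM => /andP[neq_pq /IHs->].
by rewrite /mem_stat toggle_mem.
Qed.

Variables (rk : P -> nat) (rkP : is_rank rk).

Lemma toggleability_even p I : ~~ odd (rk p) ->
  toggleability p I = mem_stat p (gyr rk I) - mem_stat p I.
Proof.
move=> even_p; set s := [seq q <- enum P | ~~ odd (rk q) & q != p].
set t := [seq q <- enum P | odd (rk q)].
(* With [p] at the head, its toggle acts on [I] itself; the later toggles, over [s] and [t], avoid
   [p] and preserve [mem_stat p]. *)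
rewrite (@gyrE _ _ rk (p :: s) t) //=.
- rewrite big_cons !permM !mem_stat_toggle_prod ?mem_filter ?eqxx ?andbF //.
    by rewrite mem_stat_toggle addrC addKr.
  by rewrite (negPf even_p).
- by rewrite mem_filter eqxx andbF filter_uniq ?enum_uniq.
- move=> q; rewrite inE mem_filter mem_enum andbT.
  by case: eqVneq => [->|_]; rewrite ?even_p ?andbT.
- by rewrite filter_uniq ?enum_uniq.
- by move=> q; rewrite mem_filter mem_enum andbT.
Qed.

Lemma toggleability_gyr_odd p I : odd (rk p) ->
  toggleability p (gyr rk I) = mem_stat p I - mem_stat p (gyr rk I).
Proof.
move=> odd_p; set s := [seq q <- enum P | ~~ odd (rk q)].
set t := [seq q <- enum P | odd (rk q) & q != p].
(* With [p] at the end, [gyr rk I] is [toggle p J], where [J] arises from [I] by toggles away from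
   [p]; hence [mem_stat p J = mem_stat p I]. *)
rewrite (@gyrE _ _ rk s (rcons t p)) //=.
- rewrite -cats1 big_cat big_seq1 !permM toggleability_toggle mem_stat_toggle.
  rewrite !mem_stat_toggle_prod ?mem_filter ?eqxx ?andbF ?odd_p //.
  by rewrite opprD addNKr.
- by rewrite filter_uniq ?enum_uniq.
- by move=> q; rewrite mem_filter mem_enum andbT.
- by rewrite rcons_uniq mem_filter eqxx andbF filter_uniq ?enum_uniq.
- move=> q; rewrite mem_rcons inE mem_filter mem_enum andbT.
  by case: eqVneq => [->|_]; rewrite ?odd_p ?andbT.
Qed.

End Toggleability.

Theorem theorem6p7 (d : Order.disp_t) (P : finPOrderType d) (rk : P -> nat)
    (rkP : is_rank rk) (p : P) :
  homomesic (gyr rk) (toggleability p) 0%R.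
Proof.
move=> O orbO; suff ->: \sum_(I in O) toggleability p I = 0 by rewrite mulr0.
have [odd_p|even_p] := boolP (odd (rk p)).
  (* The odd-rank identity evaluates the statistic at [gyr rk I], so the sum is shifted along the
     orbit before it is applied. *)
  rewrite -(sum_porbit_shift _ orbO).
  under eq_bigr => I _ do rewrite toggleability_gyr_odd //.
  by rewrite sumrB (sum_porbit_shift (mem_stat p) orbO) subrr.
under eq_bigr => I _ do rewrite (toggleability_even rkP) //.
by rewrite sumrB (sum_porbit_shift (mem_stat p) orbO) subrr.
Qed.
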